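(* Let $r\geq s\geq 1$ be integers, and let $F_m(k)$ and $p_k$ be as defined in the context (both depend on $r,s$). For any $\varepsilon>0$, any integer $k\geq 0$ and any $\alpha<1$, $$\mathbb{P}\left(\left|\frac{F_{m'}(k)}{2m'}-p_k\right|<\varepsilon\ \text{ for all } m'\geq m\right)=1-O(\exp(-m^\alpha))\qquad\text{as } m\to\infty,$$ where the implied constant may depend on $r,s,k,\varepsilon,\alpha$ but not on $m$.
   Context: The process (preferential attachment with choice): fix integers $r\geq s\geq 1$. A tree is grown in discrete time, starting from the two-vertex tree (a single edge) at time $1$. At each time step, an ordered $r$-tuple of existing vertices is selected with replacement (the same vertex may appear more than once), the $r$ choices being independent and each choosing a vertex with probability proportional to its current degree. Then a new vertex is added and joined by an edge to the vertex with rank $s$ by degree (i.e. the $s$th highest degree, counted with multiplicity) among the $r$ vertices chosen, ties being broken uniformly at random. Thus at time $m$ the tree has $m$ edges and total degree $2m$. $F_m(k)$ denotes the sum of the degrees of the vertices with degree at most $k$ in the tree at time $m$. $B_{r,s}(p)$ denotes the probability that a binomial $\operatorname{Bin}(r,p)$ random variable takes a value greater than $r-s$, for $p\in[0,1]$. For $x,p\in[0,1]$ and integers $k\geq 0$ let $$f_k(x,p)=(k+1)B_{r,s}(p)-kB_{r,s}(x)-2x+1 .$$ For every $p\in[0,1)$ there is a unique $x\in(0,1)$ with $f_k(x,p)=0$. The sequence $(p_k)_{k\geq 0}$ is defined by $p_0=0$ and, for each $k\geq 1$, $p_k$ is the unique value in $(0,1)$ with $f_k(p_k,p_{k-1})=0$.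 *)

(* Defs.v *)
(* MathComp / MathComp-Analysis *)
From HB Require Import structures.
From mathcomp Require Import all_boot all_order all_algebra.
From mathcomp Require Import all_classical all_reals all_analysis.

Set Implicit Arguments.
Unset Strict Implicit.
Unset Printing Implicit Defensive.

Import Order.TTheory GRing.Theory Num.Theory.

Local Open Scope classical_set_scope.
Local Open Scope ring_scope.

(* A growing tree, as the list of its edges in order of insertion: vertices are
   numbered 0, 1, 2, ... in order of birth, so a tree with m edges has vertex
   set {0, ..., m}, and the list also records the past of the tree. *)
Definition gtree := seq (nat * nat).

Definition vertex (t : gtree) := 'I_(size t).+1.

Definition single_edge : gtree := [:: (0%N, 1%N)].

Definition add_leaf (t : gtree) (v : nat) : gtree := rcons t (v, (size t).+1).

Definition degree (t : gtree) (v : nat) : nat :=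
  count (fun e : nat * nat => (e.1 == v) || (e.2 == v)) t.

Definition total_degree (t : gtree) : nat := (\sum_(v : vertex t) degree t v)%N.

Definition low_degree_sum (t : gtree) (k : nat) : nat :=
  (\sum_(v : vertex t | (degree t v <= k)%N) degree t v)%N.

Section choice.
Context {R : realType} (r s : nat) (t : gtree).

Definition choice_prob (c : r.-tuple (vertex t)) : R :=
  \prod_(v <- c) ((degree t v)%:R / (total_degree t)%:R).

(* The s-th highest degree (s counted from 1) among the chosen vertices. *)
Definition rank_degree (c : r.-tuple (vertex t)) : nat :=
  nth 0%N (sort geq [seq degree t v | v : vertex t <- c]) s.-1.

(* Uniform tie-breaking among the entries of c, with multiplicity, that have
   the s-th highest degree. *)
Definition select_prob (c : r.-tuple (vertex t)) (v : vertex t) : R :=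
  if degree t v == rank_degree c then
    (count_mem v c)%:R /
    (count (fun u : vertex t => degree t u == rank_degree c) c)%:R
  else 0.

Definition attach_prob (v : vertex t) : R :=
  \sum_(c : r.-tuple (vertex t)) choice_prob c * select_prob c v.

End choice.

(* T m is the tree at time m >= 1; T 0 plays no role. The law of the process is
   prescribed through its one-step transitions given the whole past. *)
Record pa_choice_process {R : realType} (r s : nat) {d : measure_display}
    {Omega : measurableType d} (P : probability Omega R)
    (T : nat -> Omega -> gtree) : Prop := PaChoiceProcess {
  pa_measurable : forall (m : nat) (A : set gtree),
    (1 <= m)%N -> measurable (T m @^-1` A);
  pa_init : P [set w | T 1%N w = single_edge] = 1%E;
  pa_step : forall (m : nat) (h : nat -> gtree) (v : vertex (h m)),
    (1 <= m)%N ->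
    P [set w | (forall i, (1 <= i <= m)%N -> T i w = h i) /\
               T m.+1 w = add_leaf (h m) v] =
    (P [set w | forall i, (1 <= i <= m)%N -> T i w = h i] *
     (attach_prob r s v)%:E)%E }.

Definition binom_tail {R : realType} (r s : nat) (p : R) : R :=
  fine (binomial_prob r p [set j | (r - s < j)%N]).

Definition f_rs {R : realType} (r s k : nat) (x p : R) : R :=
  k.+1%:R * binom_tail r s p - k%:R * binom_tail r s x - 2 * x + 1.

(* For k >= 1, the point of ]0, 1[ solving the equation, which exists and is
   unique; 0 is only the default value of the choice operator. *)
Fixpoint p_seq {R : realType} (r s k : nat) : R :=
  if k is k'.+1 then
    xget 0 [set x : R | 0 < x < 1 /\ f_rs r s k x (p_seq r s k') = 0]
  else 0.

(* Main.v *)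
Require Import Defs.
From HB Require Import structures.
From mathcomp Require Import all_boot all_order all_algebra.
From mathcomp Require Import all_classical all_reals all_analysis.
From mathcomp Require Import ring lra zify.

Import Order.TTheory GRing.Theory Num.Theory.
Import numFieldNormedType.Exports.

Local Open Scope classical_set_scope.
Local Open Scope ring_scope.

(** Write n for the number of edges of the tree, F_k for the total degree of the
    vertices of degree at most k, and x_k = F_k / 2n, the chance that one choice
    falls on such a vertex.  The selected vertex has degree at most k exactly
    when more than r - s of the r choices do, so this has probability B(x_k),
    with B the binomial tail ([attach_prob_le]).  The new leaf adds 1 to F_k, a
    selected vertex of degree below k adds 1 more, and one of degree k removes k;
    hence, for k >= 1, F_k has mean increment 1 + (k+1) B(x_(k-1)) - k B(x_k).
    The equation defining p_k says that this equals 2 p_k when x_(k-1) = p_(k-1)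
    and x_k = p_k ([p_seq_balance]).

    The proof is by induction on k, for an exponential bound at a fixed time
    ([mean_deviation]): for some c > 0, |x_k - p_k| >= eps has probability
    O(exp (- c n)) at the time when the tree has n edges.  Consider the excess
    Y = F_k - 2n p_k.  Its jumps are bounded, and as B is nondecreasing,
    whenever x_(k-1) is close to p_(k-1) the drift of Y is at most a small
    constant while Y >= 0, and at least the opposite constant while Y <= 0.
    For sigma = 1 or -1 this gives, with W = exp (l sigma Y) and l small, that
    one step multiplies the mean of W by at most exp (l eps), up to an additive
    constant (W is at most 1 when sigma Y <= 0) and up to a term supported on
    the trees where x_(k-1) is far from p_(k-1) ([step_exp_excess]).  Since
    |Y| <= 2n, that term has mean at most a constant times
    exp (2 l n) P(x_(k-1) far from p_(k-1)), which stays bounded once 2 l is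
    below the exponential rate obtained for k - 1.  So W has mean
    O(exp (l eps n)), whereas |x_k - p_k| >= eps means W >= exp (2 l eps n) for
    one of the signs, and the claim for k follows from Markov's inequality.
    Working with one time only, and choosing l after the rate for k - 1, is what
    avoids stopping times and conditioning on the past.

    The tree at time j + 1 takes finitely many values almost surely, so its law
    is that of a finite iteration of the one-step mean operator ([mean_law]); all
    the estimates are made on finite sums.  Summing the geometric bounds over
    m' >= m gives the theorem with exp (- c m), and m ^ alpha <= c m eventually
    since alpha < 1. *)

(** * The binomial tail *)

(** The probability that a Bin(n, p) variable is at least i, obtained by
    conditioning on one trial.  Monotonicity, the Lipschitz bound and strictness
    below 1 all follow from this recursion by induction; as a function of p it is
    a polynomial, hence meaningful and continuous on the whole line. *)
Fixpoint btail {R : realType} (n i : nat) (p : R) : R :=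
  match n, i with
  | _, 0 => 1
  | 0, _.+1 => 0
  | n'.+1, i'.+1 => p * btail n' i' p + (1 - p) * btail n' i p
  end.

Section btail.
Context {R : realType}.
Implicit Types (n i : nat) (p q : R).

Lemma btail_n0 n p : btail n 0 p = 1. Proof. by case: n. Qed.

Lemma btailSS n i p :
  btail n.+1 i.+1 p = p * btail n i p + (1 - p) * btail n i.+1 p.
Proof. by []. Qed.

Lemma btail_itv n i p : 0 <= p <= 1 -> 0 <= btail n i p <= 1.
Proof.
move=> p01; elim: n i => [|n IH] [|i] /=; rewrite ?lexx ?ler01//.
by have := IH i; have := IH i.+1; nra.
Qed.

Lemma btailS_le n i p : 0 <= p <= 1 -> btail n i.+1 p <= btail n i p.
Proof.
move=> p01; elim: n i => [|n IH] [|i]; rewrite ?ler01//.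
  by rewrite btail_n0; have /andP[] := @btail_itv n.+1 1 p p01.
by rewrite !btailSS; have := IH i; have := IH i.+1; nra.
Qed.

(** The increment from p to q of the right-hand side of the recursion is a convex
    combination of increments at rank n plus q - p times the difference of two
    consecutive tails, which is nonnegative, and at most 1. *)
Lemma btail_le n i p q : 0 <= p -> p <= q -> q <= 1 ->
  btail n i p <= btail n i q.
Proof.
move=> p0 pq q1; elim: n i => [|n IH] [|i]//; rewrite !btailSS.
have : btail n i.+1 p <= btail n i p by apply: btailS_le; lra.
by have := IH i; have := IH i.+1; nra.
Qed.

Lemma btail_lip n i p q : 0 <= p -> p <= q -> q <= 1 ->
  btail n i q - btail n i p <= n%:R * (q - p).
Proof.
move=> p0 pq q1; elim: n i => [|n IH] [|i]; rewrite ?btail_n0 ?subrr ?mul0r//.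
  by rewrite mulr_ge0 ?subr_ge0.
rewrite !btailSS -natr1.
have p01 : 0 <= p <= 1 by lra.
have := btail_itv n i p p01; have := btail_itv n i.+1 p p01.
by have := IH i; have := IH i.+1; nra.
Qed.

Lemma btail_dist n i p q : 0 <= p <= 1 -> 0 <= q <= 1 ->
  `|btail n i q - btail n i p| <= n%:R * `|q - p|.
Proof.
wlog pq : p q / p <= q.
  move=> H p01 q01; have [/H->//|/ltW/H] := leP p q.
  by rewrite distrC [`|p - q|]distrC; exact.
move=> /andP[p0 _] /andP[_ q1].
by rewrite !ger0_norm ?subr_ge0 ?btail_le// btail_lip.
Qed.

Lemma btail_lt1 n i p : 0 <= p -> p < 1 -> btail n i.+1 p < 1.
Proof.
move=> p0 p1; elim: n i => [|n IH] i; rewrite ?ltr01//= -/btail.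
have p01 : 0 <= p <= 1 by lra.
have := btail_itv n i p p01; have := IH i.
by nra.
Qed.

Lemma btail_at0 n i : btail n i.+1 (0 : R) = 0.
Proof. by elim: n i => //= n IH i; rewrite IH mul0r mulr0 addr0. Qed.

Lemma btail_at1 n i : (i <= n)%N -> btail n i (1 : R) = 1.
Proof.
elim: n i => [|n IH] [|i]// i_n.
by rewrite btailSS subrr mul0r addr0 mul1r IH.
Qed.

Lemma continuous_btail n i : continuous (btail n i : R -> R).
Proof.
elim: n i => [|n IH] [|i] x; try exact: cvg_cst.
apply: cvgD; apply: cvgM; [exact: cvg_id | exact: IH | | exact: IH].
by apply: cvgB; [exact: cvg_cst | exact: cvg_id].
Qed.

(** Conditioning a binomial expectation on one trial, that is, Pascal's rule. *)
Lemma binomial_sumS n p (g : nat -> R) :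
  \sum_(j < n.+2) g j * (p ^+ j * (1 - p) ^+ (n.+1 - j)) *+ 'C(n.+1, j) =
  p * (\sum_(j < n.+1) g j.+1 * (p ^+ j * (1 - p) ^+ (n - j)) *+ 'C(n, j)) +
  (1 - p) * (\sum_(j < n.+1) g j * (p ^+ j * (1 - p) ^+ (n - j)) *+ 'C(n, j)).
Proof.
rewrite big_ord_recl /= bin0 mulr1n expr0 subn0.
under eq_bigr => j _ do rewrite /bump leq0n add1n binS mulrnDr subSS.
rewrite big_split /= addrA addrC; congr (_ + _).
  rewrite mulr_sumr; apply: eq_bigr => j _.
  by rewrite mulrnAr exprS -[p * _ * _]mulrA mulrCA.
rewrite big_ord_recr /= bin_small// mulr0n addr0.
rewrite big_ord_recl /= bin0 mulr1n expr0 subn0 mulrDr exprS mulr_sumr.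
congr (_ + _); first by rewrite mulrCA !mul1r mulrCA.
apply: eq_bigr => j _; rewrite /bump leq0n add1n mulrnAr.
have -> : (n - j = (n - j.+1).+1)%N by have := ltn_ord j; lia.
by rewrite [(1 - p) ^+ _.+1]exprS [p ^+ _ * (_ * _)]mulrCA [g _ * _]mulrCA.
Qed.

Lemma binomial_sum_btail n i p :
  \sum_(j < n.+1) (i <= j)%:R * (p ^+ j * (1 - p) ^+ (n - j)) *+ 'C(n, j)
  = btail n i p.
Proof.
elim: n i => [|n IH] i.
  by rewrite big_ord1 !expr0 bin0; case: i => [|i] /=; rewrite !mulr1.
rewrite (binomial_sumS n p (fun j => (i <= j)%:R)) IH; case: i => [|i]; last first.
  by rewrite btailSS -[in RHS]IH.
by rewrite [X in p * X](IH 0%N) !btail_n0 !mulr1 addrC subrK.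
Qed.

Lemma binom_tailE r s p : 0 <= p <= 1 ->
  binom_tail r s p = btail r (r - s).+1 p.
Proof.
move=> /andP[p0 p1]; rewrite /binom_tail binomial_probE -binomial_sum_btail.
rewrite sumEFin /=.
by apply: eq_bigr => j _; rewrite indicE mem_setE mulrC mulrnAr.
Qed.

End btail.

(** * The limiting proportions *)

Section p_seq.
Context {R : realType}.
Variables (r s : nat).
Hypotheses (hs : (1 <= s)%N) (hsr : (s <= r)%N).

Local Notation tail := (btail r (r - s).+1).

(** Intermediate value theorem: the function of x is positive at 0, where the tail
    vanishes, and negative at 1, where the tail is 1, because the tail at p < 1
    is less than 1. *)
Lemma exists_p_seq_step k (p : R) : 0 <= p < 1 ->
  exists x : R, 0 < x < 1 /\ f_rs r s k x p = 0.
Proof.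
move=> p01.
pose g (x : R) := k.+1%:R * tail p - k%:R * tail x - 2 * x + 1.
have g0 : 0 < g 0.
  rewrite /g btail_at0 !mulr0 !subr0 ltr_wpDl// mulr_ge0//.
  by have /andP[] : 0 <= tail p <= 1 by apply: btail_itv; lra.
have g1 : g 1 < 0.
  rewrite /g btail_at1; last by lia.
  have : tail p < 1 by apply: btail_lt1; lra.
  have k0 : 0 <= k%:R :> R by [].
  by rewrite -natr1; nra.
have gc : continuous g.
  move=> x; apply: cvgD; last exact: cvg_cst.
  apply: cvgB; last by apply: cvgM; [exact: cvg_cst|exact: cvg_id].
  apply: cvgB; first exact: cvg_cst.
  by apply: cvgM; [exact: cvg_cst|exact: continuous_btail].
have [|x /itvP x01 gx] := @IVT R g 0 1 0 ler01 (continuous_subspaceT gc).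
  by rewrite ge_min le_max (ltW g1) (ltW g0) !orbT.
have x0 : x != 0 by apply/eqP => x0; move: g0; rewrite -[X in g X]x0 gx ltxx.
have x1 : x != 1 by apply/eqP => x1; move: g1; rewrite -[X in g X]x1 gx ltxx.
exists x; split; first by rewrite !lt_neqAle eq_sym x0 x1 !x01.
have p01' : 0 <= p <= 1 by lra.
by rewrite /f_rs !binom_tailE ?x01 //; exact: gx.
Qed.

Lemma p_seq_itv k : 0 <= (p_seq r s k : R) < 1.
Proof.
elim: k => [|k IH]; first by rewrite lexx ltr01.
have [/andP[/ltW -> ->]] := xgetPex 0 (exists_p_seq_step k.+1 _ IH).
by [].
Qed.

(** At (p_k, p_(k+1)) the mean increment of the low degree sum is the speed that
    keeps the low fraction at p_(k+1). *)
Lemma p_seq_balance k :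
  1 + k.+2%:R * tail (p_seq r s k) - k.+1%:R * tail (p_seq r s k.+1)
  = 2 * p_seq r s k.+1 :> R.
Proof.
have := xgetPex 0 (exists_p_seq_step k.+1 _ (p_seq_itv k)).
have /andP[p0 p1] := p_seq_itv k; have /andP[q0 q1] := p_seq_itv k.+1.
rewrite -[xget _ _]/(p_seq r s k.+1) => -[_].
by rewrite /f_rs !binom_tailE ?p0 ?q0 ?(ltW p1) ?(ltW q1)//; lra.
Qed.

End p_seq.

(** * The degree of the selected vertex *)

Lemma big_tuple_cons (R : pzSemiRingType) (V : finType) n
    (F : n.+1.-tuple V -> R) :
  \sum_c F c = \sum_v \sum_(c : n.-tuple V) F [tuple of v :: c].
Proof.
rewrite pair_big (reindex (fun q : V * n.-tuple V => [tuple of q.1 :: q.2])) //=.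
exists (fun c => (thead c, [tuple of behead c])) => [[v c] _ | c _] /=.
  by congr pair; apply: val_inj.
by rewrite -tuple_eta.
Qed.

(** For independent choices with law w, the number of choices in a is binomial. *)
Lemma sum_tuple_btail (R : realType) (V : finType) (w : V -> R) (a : pred V)
    n i :
  \sum_v w v = 1 ->
  \sum_(c : n.-tuple V) (\prod_(v <- c) w v) * (i <= count a c)%:R
  = btail n i (\sum_(v | a v) w v).
Proof.
move=> w1; elim: n i => [|n IH] i.
  rewrite (big_pred1 [tuple]) => [|c]; last by apply/esym/eqP; exact: tuple0.
  by rewrite big_nil mul1r; case: i.
rewrite big_tuple_cons.
have split_w (f g : R) :
    \sum_v w v * (if a v then f else g)
    = (\sum_(v | a v) w v) * f + (1 - \sum_(v | a v) w v) * g.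
  rewrite (bigID a) /= -w1 [X in X - _](bigID a) /= addrAC subrr add0r.
  by rewrite !mulr_suml; congr (_ + _); apply: eq_bigr => v;
    [move=> -> | move/negbTE=> ->].
have -> : btail n.+1 i (\sum_(v | a v) w v) =
    \sum_v w v * (if a v then btail n i.-1 (\sum_(v | a v) w v)
                  else btail n i (\sum_(v | a v) w v)).
  by rewrite split_w; case: i => [|i] //; rewrite !btail_n0 !mulr1 addrC subrK.
apply: eq_bigr => v _; rewrite -(fun_if (fun i => btail n i _)) -IH mulr_sumr.
apply: eq_bigr => c _; rewrite big_cons mulrA; congr (_ * _%:R) => /=.
by case: ifP => _; case: i => [|i].
Qed.

(** In a nonincreasing sequence, the entries at most k form a final segment. *)
Lemma nth_sorted_geq (d : seq nat) i k :
  sorted geq d -> (i < size d)%N ->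
  (nth 0%N d i <= k)%N = (size d - i <= count (fun x => (x <= k)%N) d)%N.
Proof.
move=> sd id; set a := fun x => _.
have geq_trans : transitive geq by move=> y x z /= yx zy; exact: leq_trans zy yx.
have geq_refl : reflexive geq by move=> x /=.
have nth_le := sorted_leq_nth geq_trans geq_refl 0%N sd.
have [dk|kd] := leqP (nth 0%N d i) k.
  rewrite -[d in count _ d](cat_take_drop i) count_cat -size_drop.
  suff /eqP -> : count a (drop i d) == size (drop i d) by rewrite leq_addl.
  rewrite -all_count; apply/(all_nthP 0%N) => j; rewrite size_drop => jd.
  rewrite nth_drop /a (leq_trans _ dk)//.
  by apply: nth_le; rewrite ?inE ?leq_addr//; lia.
apply/esym/negbTE; rewrite -ltnNge.
rewrite -[d in count _ d](cat_take_drop i.+1) count_cat.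
suff -> : count a (take i.+1 d) = 0%N.
  by have := count_size a (drop i.+1 d); rewrite size_drop; lia.
apply/eqP; rewrite -leqn0 leqNgt -has_count -all_predC.
apply/(all_nthP 0%N) => j; rewrite size_take_min => jd.
rewrite nth_take /=; last by lia.
rewrite -ltnNge (leq_trans kd)//.
by apply: nth_le; rewrite ?inE//; lia.
Qed.

Lemma sum_count_mem (V : finType) (a : pred V) (c : seq V) :
  (\sum_(v | a v) count_mem v c = count a c)%N.
Proof.
elim: c => [|u c IH] /=; first by rewrite big1.
rewrite big_split /= IH; congr (_ + _)%N; rewrite big_mkcond (bigD1 u) //= eqxx.
rewrite big1 => [|v /negbTE vu]; first by rewrite addn0; case: (a u).
by rewrite eq_sym vu if_same.
Qed.

(** In insertion order every edge goes from an older vertex to a newer one; in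
    particular there is no loop, and the next vertex to be born has degree 0. *)
Definition valid (t : gtree) :=
  (0 < size t)%N && all (fun e => (e.1 < e.2)%N && (e.2 <= size t)%N) t.

(** Handshake lemma; the endpoints of an edge must differ because [degree] counts
    a loop only once. *)
Lemma sum_degree (t : gtree) N :
  all (fun e => (e.1 < e.2)%N && (e.2 < N)%N) t ->
  (\sum_(v < N) degree t v = 2 * size t)%N.
Proof.
elim: t => [|e t IH] /=; first by rewrite big1.
case/andP=> /andP[e12 e2N] /IH {}IH; rewrite big_split /= IH.
have sum_eq a : (a < N)%N -> (\sum_(v < N) (a == v) = 1)%N.
  move=> aN; rewrite (bigD1 (Ordinal aN)) //= eqxx big1 // => v.
  by rewrite eq_sym -val_eqE /= => /negbTE ->.
rewrite (_ : (\sum_(v < N) _)%N = \sum_(v < N) ((e.1 == v) + (e.2 == v)))%N.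
  rewrite big_split /= !sum_eq ?(ltn_trans e12)//; lia.
apply: eq_bigr => v _; case: (e.1 =P v) => [e1v|_]; case: (e.2 =P v) => e2v //.
by move: e12; rewrite e1v e2v ltnn.
Qed.

Lemma total_degreeE t : valid t -> total_degree t = (2 * size t)%N.
Proof. by move=> /andP[_ tv]; exact: sum_degree. Qed.

Definition low_fraction {R : realType} (k : nat) (t : gtree) : R :=
  (low_degree_sum t k)%:R / (2 * (size t)%:R).

Section attach.
Context {R : realType}.
Variables (r s : nat) (t : gtree).
Hypotheses (hs : (1 <= s)%N) (hsr : (s <= r)%N) (tv : valid t).

(** The s-th highest of r degrees is at most k when fewer than s of them exceed
    k. *)
Lemma rank_degree_le k (c : r.-tuple (vertex t)) :
  (rank_degree s c <= k)%N
  = ((r - s).+1 <= count (fun v : vertex t => (degree t v <= k)%N) c)%N.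
Proof.
have geq_total : total geq by move=> x y; exact: leq_total.
rewrite /rank_degree nth_sorted_geq; last 2 first.
- exact: sort_sorted.
- by rewrite size_sort size_map size_tuple; lia.
rewrite size_sort size_map size_tuple count_sort count_map.
by congr (_ <= _)%N; lia.
Qed.

Lemma select_prob_le k (c : r.-tuple (vertex t)) :
  \sum_v select_prob s c v * (degree t v <= k)%:R
  = (rank_degree s c <= k)%:R :> R.
Proof.
set a := fun u : vertex t => degree t u == rank_degree s c.
have ac : (0 < count a c)%N.
  rewrite -has_count; apply/hasP.
  have : rank_degree s c \in [seq degree t v | v : vertex t <- c].
    rewrite /rank_degree -(mem_sort geq) mem_nth//.
    by rewrite size_sort size_map size_tuple; lia.
  by move=> /mapP[u uc ru]; exists u => //; apply/eqP.
transitivity ((\sum_(v | a v) (count_mem v c)%:R)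
    * (rank_degree s c <= k)%:R / (count a c)%:R : R).
  rewrite -mulrA mulr_suml [RHS]big_mkcond; apply: eq_bigr => v _.
  rewrite /select_prob -/a /a; case: eqP => [->|_]; last by rewrite mul0r.
  by rewrite mulrAC mulrA.
have -> : \sum_(v | a v) (count_mem v c)%:R = (count a c)%:R :> R.
  by rewrite -natr_sum sum_count_mem.
by rewrite mulrAC divff ?mul1r// pnatr_eq0 -lt0n.
Qed.

Lemma attach_prob_ge0 (v : vertex t) : 0 <= attach_prob r s v :> R.
Proof.
apply: sumr_ge0 => c _; apply: mulr_ge0.
  by apply: prodr_ge0 => u _; apply: divr_ge0.
by rewrite /select_prob; case: ifP => // _; apply: divr_ge0.
Qed.

(** The law of the degree of the selected vertex: exchanging the sums over
    vertices and over tuples, the tie-breaking rule disappears, and what remains is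
    the probability that more than r - s of r independent choices have degree at
    most k. *)
Lemma attach_prob_le k :
  \sum_(v : vertex t) attach_prob r s v * (degree t v <= k)%:R
  = btail r (r - s).+1 (low_fraction k t : R).
Proof.
have t0 : (0 < size t)%N by case/andP: tv.
under eq_bigr => v _ do rewrite mulr_suml.
rewrite exchange_big /=.
pose w (v : vertex t) : R := (degree t v)%:R / (total_degree t)%:R.
have -> : low_fraction k t = \sum_(v : vertex t | (degree t v <= k)%N) w v.
  rewrite -mulr_suml -natr_sum; congr (_ / _).
  by rewrite total_degreeE// natrM.
rewrite -sum_tuple_btail; last first.
  rewrite -mulr_suml -natr_sum divff// pnatr_eq0 -lt0n.
  by rewrite -/(total_degree t) total_degreeE// muln_gt0.
apply: eq_bigr => c _; rewrite -rank_degree_le -select_prob_le mulr_sumr.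
by apply: eq_bigr => v _; rewrite mulrA.
Qed.

End attach.

(** * Expectations along the growth *)

Lemma valid_add_leaf t (v : vertex t) : valid t -> valid (add_leaf t v).
Proof.
case/andP=> t0 tv; rewrite /valid /add_leaf size_rcons all_rcons /= leqnn andbT.
rewrite ltn_ord /=; apply: sub_all tv => e /andP[-> e2] /=.
exact: leqW.
Qed.

Section growth.
Context {R : realType}.
Variables (r s : nat).
Hypotheses (hs : (1 <= s)%N) (hsr : (s <= r)%N).

(** The case of [attach_prob_le] in which k bounds all the degrees. *)
Lemma attach_prob_sum t : valid t ->
  \sum_(v : vertex t) attach_prob r s v = 1 :> R.
Proof.
move=> tv; have t0 : (0 < size t)%N by case/andP: tv.
transitivity (\sum_(v : vertex t)
    attach_prob r s v * (degree t v <= size t)%:R : R).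
  by apply: eq_bigr => v _; rewrite count_size mulr1.
rewrite attach_prob_le// (_ : low_fraction _ _ = 1) ?btail_at1//; first by lia.
rewrite /low_fraction /low_degree_sum.
rewrite (eq_bigl xpredT) => [|v]; last by rewrite count_size.
rewrite -/(total_degree t) total_degreeE// natrM divff//.
by rewrite mulf_neq0 ?pnatr_eq0 -?lt0n.
Qed.

Lemma attach_prob_affine t (g : vertex t -> R) w a b : valid t ->
  \sum_(v : vertex t) attach_prob r s v * (w * (1 + a * g v + b))
  = w * (1 + a * (\sum_(v : vertex t) attach_prob r s v * g v) + b).
Proof.
move=> tv; under eq_bigr => v _ do rewrite mulrCA.
rewrite -mulr_sumr; under eq_bigr => v _ do rewrite !mulrDr mulr1.
rewrite !big_split /= attach_prob_sum// -mulr_suml.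
rewrite attach_prob_sum// mul1r; congr (_ * (_ + _ + _)).
by rewrite mulr_sumr; apply: eq_bigr => v _; rewrite mulrCA.
Qed.

(** The transition operator of the growth: [step phi t] is the conditional
    expectation of [phi] at the next tree, given the current tree t. *)
Definition step (phi : gtree -> R) (t : gtree) : R :=
  \sum_(v : vertex t) attach_prob r s v * phi (add_leaf t v).

(** Only the trees that can be reached from t matter to the j-th iterate at t. *)
Lemma iter_step_le j (phi psi : gtree -> R) t : valid t ->
  (forall u, valid u -> size u = (size t + j)%N -> phi u <= psi u) ->
  iter j step phi t <= iter j step psi t.
Proof.
elim: j t => [|j IH] t tv le_phi /=; first by apply: le_phi; rewrite ?addn0.
apply: ler_sum => v _; apply: ler_wpM2l; first exact: attach_prob_ge0.
apply: IH; first exact: valid_add_leaf.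
by move=> u uv; rewrite size_rcons addSnnS; exact: le_phi.
Qed.

Lemma iter_step_affine j (phi psi : gtree -> R) a b c t : valid t ->
  iter j step (fun u => a * phi u + b * psi u + c) t
  = a * iter j step phi t + b * iter j step psi t + c.
Proof.
elim: j t => [|j IH] t tv //=; rewrite {1}/step.
under eq_bigr => v _ do rewrite IH ?valid_add_leaf// !mulrDr.
rewrite !big_split /= -mulr_suml attach_prob_sum// mul1r !mulr_sumr.
by congr (_ + _ + _); apply: eq_bigr => v _; rewrite mulrCA.
Qed.

(** The j-th iterate concerns the tree at time j + 1, since the single edge is the
    tree at time 1. *)
Definition mean (j : nat) (phi : gtree -> R) : R := iter j step phi single_edge.

End growth.

(** * The law of the process *)

Section law.
Context {R : realType}.
Variables (r s : nat).
Hypotheses (hs : (1 <= s)%N) (hsr : (s <= r)%N).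
Context {d : measure_display} {Omega : measurableType d}.
Variables (P : probability Omega R) (T : nat -> Omega -> gtree).
Hypothesis pa : pa_choice_process r s P T.

Definition history (h : nat -> gtree) (m : nat) : set Omega :=
  [set w | forall i, (1 <= i <= m)%N -> T i w = h i].

Definition extend (h : nat -> gtree) (m v : nat) : nat -> gtree :=
  fun i => if i == m.+1 then add_leaf (h m) v else h i.

Lemma measurable_history h m : measurable (history h m).
Proof.
rewrite (_ : history h m =
    \bigcap_(i in [set i | (1 <= i <= m)%N]) T i @^-1` [set h i]).
  apply: bigcap_measurableType => i /andP[i1 _].
  exact: pa_measurable pa _ _ i1.
by apply/seteqP; split => w /= hw i; exact: hw.
Qed.

Lemma history_extend h m v : history (extend h m v) m.+1 =
  [set w | (forall i, (1 <= i <= m)%N -> T i w = h i) /\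
           T m.+1 w = add_leaf (h m) v].
Proof.
apply/seteqP; split => w /=.
  move=> hw; split=> [i /andP[i1 im]|].
    by rewrite hw ?i1 ?leqW// /extend ltn_eqF.
  by rewrite hw /= ?leqnn// /extend eqxx.
move=> [hw Tw] i /andP[i1]; rewrite leq_eqVlt /extend.
by case: eqP => [-> _|_] /=; [exact: Tw | move=> im; apply: hw; rewrite i1].
Qed.

(** The possible next trees exhaust the history almost surely, because their
    conditional probabilities add up to 1. *)
Lemma history_partition h m (C : set Omega) :
  (1 <= m)%N -> valid (h m) -> measurable C ->
  P (history h m `&` C) =
  (\sum_(v < (size (h m)).+1) P (history (extend h m v) m.+1 `&` C))%E.
Proof.
move=> m1 hv mC; set E := history h m.
pose B (v : 'I_(size (h m)).+1) := history (extend h m v) m.+1.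
have mE : measurable E by exact: measurable_history.
have mB v : measurable (B v) by exact: measurable_history.
have tB D : trivIset setT (fun v => B v `&` D).
  move=> u v _ _ [w [[]]]; rewrite /B !history_extend => -[_ Tu] _ [[_ Tv] _].
  by move: Tv; rewrite Tu => /rcons_inj[/val_inj].
pose U := \big[setU/set0]_v B v.
have mU : measurable U by exact: bigsetU_measurable.
have PU D : measurable D -> P (U `&` D) = (\sum_v P (B v `&` D))%E.
  move=> mD; rewrite big_distrl /= measure_bigsetU_ord// => v.
  exact: measurableI.
have UE : U `<=` E.
  move=> w; rewrite /U -bigcup_mkord_ord => -[i _].
  by rewrite /B history_extend => -[].
have PEU : P (E `\` U) = 0%E.
  have PUE : P U = P E.
    rewrite -[U]setIT PU//; under eq_bigr => v _.
      rewrite setIT /B history_extend (pa_step pa)//; over.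
    by rewrite -ge0_sume_distrr ?sumEFin ?attach_prob_sum ?mule1// => v _;
      rewrite lee_fin attach_prob_ge0.
  have PE : P E = (P (E `\` U) + P E)%E.
    by rewrite -{2}PUE [LHS](measureDI P mE mU) [E `&` U]setIC setIidl.
  have fE : P E \is a fin_num by exact: fin_num_measure.
  by rewrite -[LHS](addeK _ fE) -PE subee.
have mEC : measurable (E `&` C) by exact: measurableI.
have -> : P (E `&` C) = (P (E `&` C `\` U) + P (U `&` C))%E.
  by rewrite [LHS](measureDI P mEC mU) [_ `&` U]setIC setIA [U `&` E]setIidl.
rewrite PU// (_ : P (_ `\` _) = 0%E) ?add0e//.
apply/eqP; rewrite eq_le measure_ge0 andbT -PEU.
by apply: le_measure; rewrite ?inE; [exact: measurableD..|move=> w [[]]].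
Qed.

(** Markov property: beyond a given history, the law only depends on its last
    tree. *)
Lemma history_law j h m (A : set gtree) : (1 <= m)%N -> valid (h m) ->
  P (history h m `&` T (m + j)%N @^-1` A) =
  (P (history h m) * (iter j (step r s) \1_A (h m))%:E)%E.
Proof.
elim: j h m => [|j IH] h m m1 hv.
  have Tm w : history h m w -> T m w = h m by apply; rewrite m1 leqnn.
  rewrite addn0 /= indicE; have [hA|hA] := pselect (A (h m)).
    rewrite mem_set// mule1; congr (P _); apply/seteqP.
    by split => [w []//|w hw]; split=> //=; rewrite Tm.
  rewrite memNset// mule0 (_ : _ `&` _ = set0) ?measure0//.
  by apply/seteqP; split=> // w [hw /=]; rewrite Tm.
rewrite history_partition//; last by apply: (pa_measurable pa); rewrite addnS.
rewrite /= -sumEFin.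
have PE : P (history h m) \is a fin_num.
  by apply: fin_num_measure; exact: measurable_history.
rewrite -(fineK PE) fin_num_sume_distrr//.
apply: eq_bigr => v _.
rewrite addnS -addSn IH//; last by rewrite /extend eqxx valid_add_leaf.
rewrite history_extend (pa_step pa)// {1}/extend eqxx.
by rewrite fineK// -muleA EFinM.
Qed.

Lemma mean_law j (A : set gtree) : P (T j.+1 @^-1` A) = (mean r s j \1_A)%:E.
Proof.
pose h (i : nat) := single_edge.
have P1 : P (history h 1) = 1%E.
  rewrite -(pa_init pa); congr (P _); apply/seteqP; split => w /=; first exact.
  by move=> Tw [|[|i]].
have mA : measurable (T j.+1 @^-1` A) by exact: (pa_measurable pa).
have := history_law j h 1%N A isT isT; rewrite P1 mul1e add1n => <-.
have mh := measurable_history h 1.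
have -> : P (T j.+1 @^-1` A) =
    (P (T j.+1 @^-1` A `\` history h 1) + P (history h 1 `&` T j.+1 @^-1` A))%E.
  by rewrite [LHS](measureDI P mA mh) setIC.
rewrite (_ : P (_ `\` _) = 0%E) ?add0e//.
apply/eqP; rewrite eq_le measure_ge0 andbT.
have <- : P (~` history h 1) = 0%E by rewrite probability_setC// P1 subee.
apply: le_measure; rewrite ?inE; [exact: measurableD|exact: measurableC|].
by move=> w [].
Qed.

End law.

(** * Drift *)

Lemma degree_add_leaf t (v : vertex t) u :
  degree (add_leaf t v) u =
  (degree t u + ((v == u :> nat) || ((size t).+1 == u)))%N.
Proof. by rewrite /degree /add_leaf -cats1 count_cat /= addn0. Qed.

Lemma degree_new t : valid t -> degree t (size t).+1 = 0%N.
Proof.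
case/andP=> _ tv; apply/eqP; rewrite -leqn0 leqNgt -has_count -all_predC.
apply: sub_all tv => e /andP[e12 e2] /=.
by rewrite negb_or !neq_ltn !ltnS e2 (leq_trans (ltnW e12)).
Qed.

(** The leaf contributes 1; the vertex v contributes 1 if its degree is at most k,
    and -(k+1), the loss of its whole degree, if it is k+1.  The identity is
    arranged so as to avoid subtraction in nat. *)
Lemma low_degree_sum_add_leaf t (v : vertex t) k : valid t ->
  (low_degree_sum (add_leaf t v) k.+1 + k.+1 * (degree t v <= k.+1) =
   low_degree_sum t k.+1 + 1 + k.+2 * (degree t v <= k))%N.
Proof.
move=> tv; pose f d := if (d <= k.+1)%N then d else 0%N.
have -> : low_degree_sum t k.+1 = (\sum_(u < (size t).+1) f (degree t u))%N.
  by rewrite /low_degree_sum big_mkcond.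
have -> : low_degree_sum (add_leaf t v) k.+1 =
    (\sum_(u < (size t).+2) f (degree (add_leaf t v) u))%N.
  rewrite /low_degree_sum big_mkcond.
  rewrite -(big_mkord xpredT (fun u => f (degree (add_leaf t v) u))).
  by rewrite size_rcons big_mkord.
rewrite big_ord_recr /= degree_add_leaf degree_new// eqxx orbT add0n.
rewrite (bigD1 v) //= [in RHS](bigD1 v) //= degree_add_leaf eqxx /=.
rewrite (eq_bigr (fun u : 'I__ => f (degree t u))); last first.
  move=> u /negbTE uv; rewrite degree_add_leaf eq_sym val_eqE uv /=.
  by rewrite gtn_eqF ?addn0.
move: (degree t v) (\sum_(i < _ | _) _)%N => d S; rewrite /f addn1 ltnS.
case: (leqP d k) => dk; case: (leqP d k.+1) => dk1 /=.
all: lia.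
Qed.

Lemma low_degree_sum_le t k : valid t -> (low_degree_sum t k <= 2 * size t)%N.
Proof.
move=> tv; rewrite -total_degreeE// /total_degree /low_degree_sum.
by rewrite [leqLHS]big_mkcond; apply: leq_sum => v _; case: ifP.
Qed.

(** The inequality exp (-z) >= 1 - z bounds exp z by 1 / (1 - z); the factor 2 is
    what makes z <= 1/2 sufficient for that to be below the quadratic. *)
Lemma expR_le_quadratic (R : realType) (z : R) :
  z <= 2^-1 -> expR z <= 1 + z + 2 * z ^+ 2.
Proof.
move=> z1; have e0 := expR_gt0 z; have := expR_ge1Dx (- z).
rewrite expRN => h.
have : (1 - z) * expR z <= 1 by rewrite -ler_pdivlMr// mul1r.
have : 1 <= (1 - z) * (1 + z + 2 * z ^+ 2) by nra.
have z10 : 0 < 1 - z by lra.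
by move=> ha hb; rewrite -(ler_pM2l z10); exact: le_trans hb ha.
Qed.

Section drift.
Context {R : realType}.
Variables (r s : nat).
Hypotheses (hs : (1 <= s)%N) (hsr : (s <= r)%N).

Local Notation tail := (btail r (r - s).+1).

Lemma low_fraction_itv k t : valid t -> 0 <= (low_fraction k t : R) <= 1.
Proof.
move=> tv; have t0 : (0 < size t)%N by case/andP: tv.
rewrite /low_fraction divr_ge0//= ler_pdivrMr ?mul1r.
  by rewrite -natrM ler_nat low_degree_sum_le.
by rewrite mulr_gt0 ?ltr0n.
Qed.

Definition excess (k : nat) (t : gtree) : R :=
  (low_degree_sum t k)%:R - 2 * (size t)%:R * p_seq r s k.

Definition excess_jump (k : nat) (t : gtree) (v : vertex t) : R :=
  1 + k.+2%:R * (degree t v <= k)%:R - k.+1%:R * (degree t v <= k.+1)%:R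
  - 2 * p_seq r s k.+1.

Lemma excessE k t : valid t ->
  excess k t = 2 * (size t)%:R * (low_fraction k t - p_seq r s k).
Proof.
move=> /andP[t0 _].
rewrite /excess /low_fraction mulrBr [X in _ = X - _]mulrC divfK//.
by rewrite mulf_neq0 ?pnatr_eq0 -?lt0n.
Qed.

Lemma excess_le k t : valid t -> `|excess k t| <= 2 * (size t)%:R.
Proof.
move=> tv; rewrite excessE// normrM ger0_norm// ler_piMr//.
have := low_fraction_itv k t tv; have := @p_seq_itv R r s hs hsr k.
by move=> pp ll; rewrite ler_norml; lra.
Qed.

Lemma excess_add_leaf k t (v : vertex t) : valid t ->
  excess k.+1 (add_leaf t v) = excess k.+1 t + excess_jump k t v.
Proof.
move=> tv; have := congr1 (fun n => n%:R : R) (low_degree_sum_add_leaf t v k tv).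
rewrite /excess /excess_jump !natrD !natrM size_rcons -[(size t).+1%:R]natr1.
by move=> e; nra.
Qed.

Lemma excess_jump_le k t (v : vertex t) : `|excess_jump k t v| <= k.+2%:R.
Proof.
have := @p_seq_itv R r s hs hsr k.+1; rewrite /excess_jump.
have k0 : 0 <= k%:R :> R by [].
have -> : k.+2%:R = k%:R + 2 :> R by rewrite -natr1 -natr1; lra.
have -> : k.+1%:R = k%:R + 1 :> R by rewrite -natr1.
case: (leqP (degree t v) k) => dk; first by rewrite leqW// ler_norml/=; lra.
by case: leqP => _; rewrite ler_norml/=; lra.
Qed.

(** The restoring force.  By [p_seq_balance] the drift is
    (k+2) (B(x_k) - B(p_k)) - (k+1) (B(x_(k+1)) - B(p_(k+1))).  The second
    difference has the sign of the excess, so it can only help; the first is small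
    by the Lipschitz bound on B. *)
Lemma mean_excess_jump_le k t (sigma eta : R) :
  valid t -> sigma ^+ 2 = 1 -> 0 <= sigma * excess k.+1 t ->
  `|low_fraction k t - p_seq r s k| <= eta ->
  \sum_(v : vertex t) attach_prob r s v * (sigma * excess_jump k t v)
  <= k.+2%:R * (r%:R * eta).
Proof.
move=> tv; rewrite excessE// => sg sx pe.
have t0 : 0 < (size t)%:R :> R by rewrite ltr0n; case/andP: tv.
have {}sx : 0 <= sigma * (low_fraction k.+1 t - p_seq r s k.+1).
  by move: sx; rewrite mulrCA pmulr_rge0// mulr_gt0.
have -> : \sum_(v : vertex t) attach_prob r s v * (sigma * excess_jump k t v) =
    sigma * (1 + k.+2%:R * tail (low_fraction k t)
             - k.+1%:R * tail (low_fraction k.+1 t) - 2 * p_seq r s k.+1).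
  have := attach_prob_sum r s hs hsr t tv; move/(_ R) => sum1.
  rewrite -!attach_prob_le// -[X in sigma * (X + _ - _ - _)]sum1.
  rewrite -[X in _ - X]mulr1 -[X in _ - _ * X]sum1.
  rewrite !mulr_sumr -big_split -!sumrB mulr_sumr; apply: eq_bigr => v _.
  by rewrite /excess_jump; move: (p_seq r s k.+1) => q /=; ring.
rewrite -p_seq_balance//.
have [/andP[l0 l1] /andP[m0 m1]] :=
  (low_fraction_itv k t tv, low_fraction_itv k.+1 t tv).
have [/andP[p0 p1] /andP[q0 q1]] :=
  (@p_seq_itv R r s hs hsr k, @p_seq_itv R r s hs hsr k.+1).
have h1 : 0 <= sigma * (tail (low_fraction k.+1 t) - tail (p_seq r s k.+1)).
  move/eqP: sg; rewrite sqrf_eq1 => /orP[]/eqP sE; move: sx; rewrite sE.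
    by rewrite !mul1r !subr_ge0 => xq; apply: btail_le.
  by rewrite !mulN1r !opprB !subr_ge0 => xq; apply: btail_le => //; exact: ltW.
have h2 : sigma * (tail (low_fraction k t) - tail (p_seq r s k)) <= r%:R * eta.
  apply: le_trans (ler_norm _) _; rewrite normrM.
  have -> : `|sigma| = 1.
    by apply/eqP; rewrite -(@pexpr_eq1 _ _ 2)// -normrX sg normr1.
  rewrite mul1r (le_trans (btail_dist _ _ _ _ _ _)) ?p0 ?l0 ?(ltW p1)//.
  exact: ler_wpM2l.
have k0 : 0 <= k.+1%:R :> R by [].
have k2 : 0 <= k.+2%:R :> R by [].
have := mulr_ge0 k0 h1; have := ler_wpM2l k2 h2.
by lra.
Qed.

End drift.

(** * Exponential moments *)

Section concentration.
Context {R : realType}.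
Variables (r s : nat).
Hypotheses (hs : (1 <= s)%N) (hsr : (s <= r)%N).

Definition deviation (k : nat) (eps : R) : set gtree :=
  [set t | eps <= `|low_fraction k t - p_seq r s k|].

Definition exp_excess (k : nat) (sigma l : R) (t : gtree) : R :=
  expR (l * (sigma * excess r s k t)).

Section one_step.
Variables (k : nat) (sigma l eps eta : R) (t : gtree).
Hypotheses (tv : valid t) (sg : sigma ^+ 2 = 1).
Hypotheses (l0 : 0 < l) (lk : l * k.+2%:R <= 2^-1).
Hypothesis lk2 : 2 * l * k.+2%:R ^+ 2 <= eps / 2.
Hypothesis eta_eps : k.+2%:R * (r%:R * eta) <= eps / 2.

Let W := exp_excess k.+1 sigma l.

Let norm_sigma : `|sigma| = 1.
Proof. by apply/eqP; rewrite -(@pexpr_eq1 _ _ 2)// -normrX sg normr1. Qed.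

Lemma exp_excess_add_leaf (v : vertex t) :
  W (add_leaf t v) = W t * expR (l * (sigma * excess_jump r s k t v)).
Proof. by rewrite /W /exp_excess excess_add_leaf// !mulrDr expRD. Qed.

Let jump_le (v : vertex t) : `|sigma * excess_jump r s k t v| <= k.+2%:R.
Proof. by rewrite normrM norm_sigma mul1r excess_jump_le. Qed.

Lemma step_exp_excess_le : step r s W t <= W t * expR 2^-1.
Proof.
apply: (@le_trans _ _ (\sum_(v : vertex t) attach_prob r s v * (W t * expR 2^-1))).
  apply: ler_sum => v _; apply: ler_wpM2l; first exact: attach_prob_ge0.
  rewrite exp_excess_add_leaf ler_pM2l ?expR_gt0// ler_expR.
  apply: le_trans lk; rewrite ler_pM2l//; apply: le_trans (jump_le v).
  exact: ler_norm.
by rewrite -mulr_suml attach_prob_sum// mul1r.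
Qed.

Lemma step_exp_excess_drift :
  0 <= sigma * excess r s k.+1 t -> `|low_fraction k t - p_seq r s k| <= eta ->
  step r s W t <= W t * expR (l * eps).
Proof.
move=> up near_p.
have drift := mean_excess_jump_le r s hs hsr k t sigma eta tv sg up near_p.
apply: (@le_trans _ _ (\sum_(v : vertex t) attach_prob r s v * (W t *
   (1 + l * (sigma * excess_jump r s k t v) + l * (eps / 2))))).
  apply: ler_sum => v _; apply: ler_wpM2l; first exact: attach_prob_ge0.
  rewrite exp_excess_add_leaf ler_pM2l ?expR_gt0//.
  have := jump_le v; move: (sigma * _) => z zk.
  have zk' : z <= k.+2%:R := le_trans (ler_norm z) zk.
  have z2 : z ^+ 2 <= k.+2%:R ^+ 2.
    by rewrite -[z ^+ 2]real_normK ?num_real// ler_sqr ?nnegrE.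
  apply: le_trans (expR_le_quadratic _ _ _) _.
    by apply: le_trans lk; rewrite ler_pM2l.
  rewrite lerD2l exprMn (_ : 2 * _ = l * (2 * l * z ^+ 2)); last by ring.
  rewrite ler_pM2l//; apply: le_trans lk2; rewrite ler_pM2l ?mulr_gt0//.
rewrite attach_prob_affine//.
rewrite ler_pM2l ?expR_gt0//; apply: le_trans (expR_ge1Dx _).
rewrite -addrA lerD2l -mulrDr ler_pM2l//.
by rewrite [leRHS]splitr lerD2r (le_trans drift).
Qed.

(** Three cases: if the low fraction at level k is far from its limit, the crude
    bound |excess| <= 2n is used; otherwise either the drift bound applies, or
    sigma times the excess is negative and the exponential starts below 1. *)
Lemma step_exp_excess :
  step r s W t <= expR (l * eps) * W t
    + (expR 2^-1 * expR (l * (2 * (size t)%:R))) * \1_(deviation k eta) t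
    + expR 2^-1.
Proof.
have W0 : 0 < W t by exact: expR_gt0.
have e0 : 0 < expR 2^-1 :> R by exact: expR_gt0.
have e1 : 0 < expR (l * eps) * W t by rewrite mulr_gt0 ?expR_gt0.
have e2 : 0 <= expR 2^-1 * expR (l * (2 * (size t)%:R)) *
    \1_(deviation k eta) t :> R.
  by rewrite !mulr_ge0 ?expR_ge0// indicE.
have [bad|good] := pselect (deviation k eta t).
  have : W t <= expR (l * (2 * (size t)%:R)).
    rewrite ler_expR ler_pM2l// (le_trans (ler_norm _))// normrM norm_sigma.
    by rewrite mul1r excess_le.
  have := step_exp_excess_le.
  by rewrite indicE mem_set// mulr1 => h1 h2; nra.
have [up|down] := leP 0 (sigma * excess r s k.+1 t).
  have near_p : `|low_fraction k t - p_seq r s k| <= eta.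
    by rewrite leNgt; apply/negP => /ltW.
  by have := step_exp_excess_drift up near_p; lra.
have : W t <= 1 by rewrite -expR0 ler_expR pmulr_rle0// ltW.
by have := step_exp_excess_le; nra.
Qed.

End one_step.

(** Translating u by the fixed point of the recursion makes it geometric. *)
Lemma affine_recurrence_le (u : nat -> R) (A b : R) j : 1 < A -> 0 <= b ->
  (forall i, u i.+1 <= A * u i + b) -> u j <= A ^+ j * (u 0%N + b / (A - 1)).
Proof.
move=> A1 b0 ue; set B := b / (A - 1).
have BE : A * B = b + B by rewrite /B; field; lra.
have B0 : 0 <= B by rewrite divr_ge0//; lra.
suff : u j + B <= A ^+ j * (u 0%N + B) by lra.
elim: j => [|j IH]; first by rewrite expr0 mul1r.
rewrite exprS -mulrA; apply: le_trans (_ : A * (u j + B) <= _).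
  by have := ue j; lra.
by rewrite ler_pM2l//; lra.
Qed.

Lemma mean_le j (phi psi : gtree -> R) :
  (forall t, valid t -> size t = j.+1 -> phi t <= psi t) ->
  mean r s j phi <= mean r s j psi.
Proof. by move=> le_phi; apply: iter_step_le. Qed.

Lemma mean_affine j (phi psi : gtree -> R) a b c :
  mean r s j (fun u => a * phi u + b * psi u + c)
  = a * mean r s j phi + b * mean r s j psi + c.
Proof. exact: iter_step_affine. Qed.

(** The hypothesis 2 l <= c makes the contribution of the exceptional trees,
    exp (2 l (i+1)) C exp (- c i), bounded uniformly in i. *)
Lemma exp_excess_mean k sigma l eps eta C c j :
  sigma ^+ 2 = 1 -> 0 < l -> l * k.+2%:R <= 2^-1 ->
  2 * l * k.+2%:R ^+ 2 <= eps / 2 -> k.+2%:R * (r%:R * eta) <= eps / 2 ->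
  0 < eps -> 0 <= C -> 2 * l <= c ->
  (forall i, mean r s i \1_(deviation k eta) <= C * expR (- (c * i%:R))) ->
  mean r s j (exp_excess k.+1 sigma l)
  <= expR (l * eps * j%:R) * (expR (2 * l) +
     expR 2^-1 * (expR (2 * l) * C + 1) / (expR (l * eps) - 1)).
Proof.
move=> sg l0 lk lk2 eta_eps eps0 C0 lc hC.
set b := expR 2^-1 * _.
have b0 : 0 <= b by rewrite mulr_ge0 ?expR_ge0// addr_ge0// mulr_ge0 ?expR_ge0.
have A1 : 1 < expR (l * eps) by rewrite expR_gt1 mulr_gt0.
set u := fun j => mean r s j (exp_excess k.+1 sigma l).
rewrite -/(u j).
have u0 : u 0%N <= expR (2 * l).
  have n1 : `|sigma| = 1.
    by apply/eqP; rewrite -(@pexpr_eq1 _ _ 2)// -normrX sg normr1.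
  rewrite /u /mean /= /exp_excess ler_expR [2 * l]mulrC ler_pM2l//.
  rewrite (le_trans (ler_norm _))// normrM n1 mul1r.
  by rewrite (le_trans (excess_le r s hs hsr k.+1 single_edge isT))// mulr1.
have -> : expR (l * eps * j%:R) = expR (l * eps) ^+ j.
  by rewrite mulrC expRM_natl.
apply: (le_trans (affine_recurrence_le u (expR (l * eps)) b j A1 b0 _));
  last first.
  by rewrite ler_pM2l ?exprn_gt0 ?expR_gt0// lerD2r.
move=> i; rewrite /u /mean iterSr -!/(mean _ _ _ _).
set D := expR 2^-1 * expR (l * (2 * i.+1%:R)).
apply: (@le_trans _ _ (mean r s i (fun t =>
   expR (l * eps) * exp_excess k.+1 sigma l t + D * \1_(deviation k eta) t
   + expR 2^-1))).
  apply: mean_le => t tv ti; rewrite /D -ti.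
  exact: step_exp_excess.
rewrite mean_affine -addrA lerD2l /b mulrDr mulr1 lerD2r /D -mulrA.
rewrite ler_pM2l ?expR_gt0//.
apply: le_trans (ler_wpM2l (expR_ge0 _) (hC i)) _.
rewrite mulrCA [leRHS]mulrC; apply: ler_wpM2l => //.
rewrite -expRD ler_expR -[i.+1%:R]natr1.
have i0 : 0 <= i%:R :> R by [].
by nra.
Qed.

(** At level 0 there is nothing to deviate, a sum of degrees at most 0 being 0.
    In the induction step, eta is chosen first, then the rate c at level k and
    accuracy eta, and then l, small with respect to c. *)
Lemma mean_deviation k (eps : R) : 0 < eps ->
  exists C c : R, [/\ 0 <= C, 0 < c &
    forall j, mean r s j \1_(deviation k eps) <= C * expR (- (c * j%:R))].
Proof.
elim: k eps => [|k IH] eps eps0.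
  exists 0, 1; split=> // j; rewrite mul0r.
  apply: (@le_trans _ _ (mean r s j (fun t => 0 * 0 + 0 * 0 + 0))); last first.
    by rewrite (mean_affine j (fun=> 0) (fun=> 0)) !mul0r !addr0.
  apply: mean_le => t _ _; rewrite !mul0r !addr0 indicE memNset//.
  rewrite /deviation /= subr0 /low_fraction /low_degree_sum.
  rewrite big1 => [|v]; last by rewrite leqn0 => /eqP.
  by rewrite mul0r normr0; apply/negP; rewrite -ltNge.
have k0 : 0 < k.+2%:R :> R by [].
have r0 : 0 < r%:R :> R by rewrite ltr0n (leq_trans hs).
pose eta := eps / (2 * k.+2%:R * r%:R).
have eta0 : 0 < eta by rewrite divr_gt0// !mulr_gt0.
have eta_eps : k.+2%:R * (r%:R * eta) <= eps / 2.
  rewrite /eta le_eqVlt; apply/orP; left; apply/eqP; field.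
  by rewrite !lt0r_neq0.
have [C [c [C0 c0 hC]]] := IH eta eta0.
pose l := Num.min (c / 2) (Num.min (2 * k.+2%:R)^-1 (eps / (4 * k.+2%:R ^+ 2))).
have l0 : 0 < l.
  by rewrite /l !lt_min !divr_gt0 ?invr_gt0 ?mulr_gt0 ?exprn_gt0.
have lc : 2 * l <= c.
  have : l <= c / 2 by rewrite /l ge_min lexx.
  by lra.
have lk : l * k.+2%:R <= 2^-1.
  rewrite -ler_pdivlMr// -invfM.
  by rewrite /l !ge_min lexx !orbT.
have lk2 : 2 * l * k.+2%:R ^+ 2 <= eps / 2.
  have : l <= eps / (4 * k.+2%:R ^+ 2) by rewrite /l !ge_min lexx !orbT.
  by rewrite ler_pdivlMr ?mulr_gt0 ?exprn_gt0//; lra.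
(* The same bound for both signs controls the upper and the lower deviation. *)
have moment sigma j (sg : sigma ^+ 2 = 1) := exp_excess_mean k sigma l eps eta
  C c j sg l0 lk lk2 eta_eps eps0 C0 lc hC.
set D := _ + _ / _ in moment.
have D0 : 0 <= D.
  have := moment 1 0%N (expr1n _ _); rewrite mulr0 expR0 mul1r.
  by apply: le_trans; exact: expR_ge0.
exists (2 * D), (l * eps).
split; [by rewrite mulr_ge0|by rewrite mulr_gt0|move=> j].
pose e := expR (- (l * (2 * j.+1%:R * eps))).
(* Markov's inequality: on the deviation one of the two exponentials is at least
   1 / e. *)
apply: (@le_trans _ _ (mean r s j (fun t =>
  e * exp_excess k.+1 1 l t + e * exp_excess k.+1 (-1) l t + 0))).
  apply: mean_le => t tv tj.
  have e1 : 0 <= e * exp_excess k.+1 1 l t by rewrite mulr_ge0 ?expR_ge0.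
  have e2 : 0 <= e * exp_excess k.+1 (-1) l t by rewrite mulr_ge0 ?expR_ge0.
  rewrite indicE; have [bad|good] := pselect (deviation k.+1 eps t); last first.
    by rewrite memNset// !addr_ge0.
  rewrite mem_set// addr0 /=.
  have : 2 * j.+1%:R * eps <= `|excess r s k.+1 t|.
    by rewrite excessE// normrM tj ger0_norm// ler_pM2l.
  rewrite ler_normr => /orP[] h.
    apply: (@le_trans _ _ (e * exp_excess k.+1 1 l t)); last by rewrite lerDl.
    rewrite /exp_excess mul1r -expRD -[leLHS]expR0 ler_expR addrC subr_ge0.
    by rewrite ler_pM2l.
  apply: (@le_trans _ _ (e * exp_excess k.+1 (-1) l t)); last by rewrite lerDr.
  rewrite /exp_excess mulN1r -expRD -[leLHS]expR0 ler_expR addrC subr_ge0.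
  by rewrite ler_pM2l.
rewrite mean_affine addr0.
have m1 := moment 1 j (expr1n _ _).
have m2 := moment (-1) j (etrans (sqrrN 1) (expr1n _ _)).
apply: (@le_trans _ _ (e * (expR (l * eps * j%:R) * D) * 2)).
  by rewrite -mulrDr -mulrA ler_pM2l ?expR_gt0//; lra.
have swap (a x y : R) : a * (x * y) * 2 = 2 * y * (a * x) by ring.
rewrite swap; apply: ler_wpM2l.
  by rewrite mulr_ge0.
rewrite -expRD ler_expR -[j.+1%:R]natr1.
have : 0 < l * eps by rewrite mulr_gt0.
by nra.
Qed.

End concentration.

(** * Uniform control of the tail of the process *)

Lemma powR_le_linear (R : realType) (alpha c : R) : alpha < 1 -> 0 < c ->
  exists m0 : nat, forall m : nat, (m0 <= m)%N -> m%:R `^ alpha <= c * m%:R.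
Proof.
move=> alpha1 c0; exists (Num.trunc (expR (ln c / (alpha - 1)))).+1 => m mm0.
have m0 : 0 < m%:R :> R by rewrite ltr0n (leq_trans _ mm0).
have : expR (ln c / (alpha - 1)) <= m%:R.
  apply: le_trans (_ : (Num.trunc (expR (ln c / (alpha - 1)))).+1%:R <= _).
    by rewrite ltW// truncnS_gt.
  by rewrite ler_nat.
rewrite -ler_ln ?posrE ?expR_gt0// expRK ler_ndivrMr ?subr_lt0// => h.
rewrite /powR gt_eqF// -[leRHS]lnK ?posrE ?mulr_gt0// ler_expR lnM ?posrE//.
by lra.
Qed.

Lemma bigcup_geometric_le {R : realType} {d : measure_display}
    {Omega : measurableType d} (P : probability Omega R)
    (F : nat -> set Omega) (a q : R) :
  0 <= a -> 0 <= q < 1 -> (forall i, measurable (F i)) ->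
  (forall i, (P (F i) <= (a * q ^+ i)%:E)%E) ->
  (P (\bigcup_i F i) <= (a / (1 - q))%:E)%E.
Proof.
move=> a0 /andP[q0 q1] mF PF.
apply: le_trans (measure_sigma_subadditive P mF _ (@subset_refl _ _)) _.
  exact: bigcupT_measurable.
apply: lime_le; first exact: is_cvg_nneseries.
apply: nearW => n; apply: le_trans (lee_sum _ (fun i _ => PF i)) _.
rewrite sumEFin lee_fin.
have := congr1 (fun u => u n) (@geometric_seriesE R a q (negbT (lt_eqF q1))).
rewrite seriesEnat /geometric /= => ->.
rewrite ler_pM2r ?invr_gt0 ?subr_gt0// ler_piMr// gerBl.
exact: exprn_ge0.
Qed.

Theorem theorem3 (R : realType) (r s : nat) (hs : (1 <= s)%N) (hsr : (s <= r)%N)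
    (eps : R) (heps : 0 < eps) (k : nat) (alpha : R) (halpha : alpha < 1) :
  exists (C : R) (m0 : nat),
    forall (d : measure_display) (Omega : measurableType d)
      (P : probability Omega R) (T : nat -> Omega -> gtree),
    pa_choice_process r s P T ->
    forall m : nat, (m0 <= m)%N ->
    `|1 - fine (P [set w | forall m' : nat, (m <= m')%N ->
          `|(low_degree_sum (T m' w) k)%:R / (2 * m'%:R) - p_seq r s k| < eps])|
      <= C * expR (- (m%:R `^ alpha)).
Proof.
have [C [c [C0 c0 hC]]] := mean_deviation r s hs hsr k eps heps.
have [m0 hm0] := powR_le_linear R alpha c halpha c0.
have q1 : 0 <= expR (- c) < 1 by rewrite expR_ge0 -expR0 ltr_expR oppr_lt0.
exists (C * expR c / (1 - expR (- c))), m0.+1 => d Omega P T pa [//|m] mm0.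
(* A deviation measured with the time i; it agrees with the one measured with the
   size of the tree only on trees of size i, hence almost surely. *)
pose B i : set gtree :=
  [set t | eps <= `|(low_degree_sum t k)%:R / (2 * i%:R) - p_seq r s k|].
pose F i := T (i + m).+1 @^-1` B (i + m).+1.
have mF i : measurable (F i) by exact: (pa_measurable pa).
have PF i : (P (F i) <= (C * expR (- (c * m%:R)) * expR (- c) ^+ i)%:E)%E.
  rewrite /F (mean_law r s hs hsr P T pa) lee_fin.
  have -> : C * expR (- (c * m%:R)) * expR (- c) ^+ i
      = C * expR (- (c * (i + m)%:R)).
    by rewrite -expRM_natl -mulrA -expRD natrD; congr (_ * expR _); ring.
  apply: le_trans (hC (i + m)%N); apply: mean_le => // t _ tm.
  have Bdev : B (i + m).+1 t = deviation r s k eps t.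
    by rewrite /B /deviation /low_fraction /= tm.
  by rewrite !indicE /in_mem /= /in_set Bdev.
set E := [set w | _].
have EE : E = ~` (\bigcup_i F i).
  apply/seteqP; split => w /=.
    move=> Ew [i _]; rewrite /F /B /=.
    by apply/negP; rewrite -ltNge; apply: Ew; rewrite ltnS leq_addl.
  move=> nF [//|m']; rewrite ltnS => mm'; rewrite ltNge; apply/negP => Bw.
  by apply: nF; exists (m' - m)%N => //; rewrite /F /B /= subnK.
have mU : measurable (\bigcup_i F i) by exact: bigcupT_measurable.
have PU := bigcup_geometric_le P F _ _ (mulr_ge0 C0 (expR_ge0 _)) q1 mF PF.
rewrite EE probability_setC//.
have fU : P (\bigcup_i F i) \is a fin_num by exact: fin_num_measure.
rewrite fineB// opprB addrC subrK ger0_norm ?fine_ge0//.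
apply: (@le_trans _ _ (C * expR (- (c * m%:R)) / (1 - expR (- c)))).
  by rewrite -lee_fin fineK.
rewrite [leRHS]mulrAC ler_pM2r; last first.
  by rewrite invr_gt0 subr_gt0; case/andP: q1.
rewrite -mulrA ler_wpM2l// -expRD ler_expR.
have := hm0 m.+1 (ltnW mm0).
have -> : c * m.+1%:R = c * m%:R + c by rewrite -natr1 mulrDr mulr1.
by lra.
Qed.
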